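(* Let $G$ be a finite simple graph that has a dominating clique. Then $G$ admits an antimagic orientation.
   Context: All graphs are finite and simple. A dominating clique of a graph $G$ is a nonempty clique $K\subseteq V(G)$ (a set of $k\ge 1$ pairwise adjacent vertices) such that every vertex of $G$ lies in $K$ or has a neighbour in $K$. Let $m=|E(G)|$. For an orientation $D$ of $G$ (each edge is given exactly one direction; $A(D)$ is the resulting set of arcs) and a bijection $\tau\colon A(D)\to\{1,\dots,m\}$, the oriented vertex sum of a vertex $v$ is $$s(v)=\sum_{(u,v)\in A(D)}\tau(uv)-\sum_{(v,w)\in A(D)}\tau(vw),$$ i.e. the sum of labels on arcs into $v$ minus the sum of labels on arcs out of $v$. The graph $G$ admits an antimagic orientation if there exist such $D$ and $\tau$ for which the values $s(v)$, $v\in V(G)$, are pairwise distinct. *)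

(* Defs.v *)
From mathcomp Require Import all_boot all_order all_algebra.

Set Implicit Arguments.
Unset Strict Implicit.
Unset Printing Implicit Defensive.

Import GRing.Theory.

(* A finite simple graph is a finite type T of vertices with an adjacency
   relation e : rel T that is symmetric and irreflexive. *)

Definition edges (T : finType) (e : rel T) : {set {set T}} :=
  [set [set p.1; p.2] | p : T * T & e p.1 p.2].

Definition clique (T : finType) (e : rel T) (K : {set T}) : Prop :=
  {in K &, forall u v, u != v -> e u v}.

Definition dominating_clique (T : finType) (e : rel T) (K : {set T}) : Prop :=
  [/\ K != set0,
      clique e K &
      forall v, v \in K \/ exists2 u, u \in K & e v u].

(* D is the set of arcs; the pair (u, v) is the arc from u to v. *)
Definition orientation (T : finType) (e : rel T) (D : {set T * T}) : Prop :=
  (forall u v, (u, v) \in D -> e u v) /\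
  (forall u v, e u v -> ((u, v) \in D) (+) ((v, u) \in D)).

(* tau restricts to a bijection from D onto {1, ..., m}; its values outside D
   are irrelevant. *)
Definition arc_labelling (T : finType) (D : {set T * T}) (m : nat)
    (tau : T * T -> nat) : Prop :=
  [/\ {in D &, injective tau},
      {in D, forall a, 1 <= tau a <= m} &
      forall k, 1 <= k <= m -> exists2 a, a \in D & tau a = k].

Definition vertex_sum (T : finType) (D : {set T * T}) (tau : T * T -> nat)
    (v : T) : int :=
  (\sum_(u | (u, v) \in D) (tau (u, v))%:Z
   - \sum_(w | (v, w) \in D) (tau (v, w))%:Z)%R.

Definition admits_antimagic_orientation (T : finType) (e : rel T) : Prop :=
  exists (D : {set T * T}) (tau : T * T -> nat),
    [/\ orientation e D,
        arc_labelling D #|edges e| tau &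
        injective (vertex_sum D tau)].

(* Main.v *)
Require Import Defs.
From mathcomp Require Import all_boot all_order all_algebra.
From mathcomp Require Import zify.
Set Implicit Arguments.
Unset Strict Implicit.
Unset Printing Implicit Defensive.
Import Order.TTheory GRing.Theory Num.Theory.

(** Let K be a dominating clique of least size, k its size, a = 'C(k, 2), and
W the complement of K.  All edges between K and W are oriented from K to W;
the edges inside K receive the labels 1, ..., a and all others the larger
labels.  This makes the sums on W positive and those on K negative, and
within each of the two sets the last labels to be assigned separate the sums.

W side ([outer_labelling]).  Each w in W chooses one edge to a vertex f w of
K, and the chosen edges get the largest labels of all.  Once everything else
is labelled, they are distributed in increasing order of the sums obtained so
far, which makes the sums on W distinct ([separating_order]).  The edges
inside W are oriented so that they contribute at most their largest label, in
absolute value, to each vertex ([balanced_orientation]); the chosen edge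
outweighs this, so every sum on W is positive.

K side ([inner_labelling]).  By now each v in K has a fixed load P v, the sum
of the labels of its edges to W.  Let z minimise P on K.  The star at z gets
the labels 1, ..., k - 1 and points towards z, so z gains 1 + ... + (k - 1),
which is a.  The rest of the clique gets k, ..., a with a balanced
orientation, so every other vertex gains less than a and stays strictly below
z; the star labels are again distributed so as to separate these vertices.
Since K has least size, each of its vertices has a neighbour in W (unless W
is empty), so its load is at least a + 1 while its gain is at most a, and its
sum is negative.

Balanced orientations need no Euler tour.  At each vertex pair up the
incident edge ends, in decreasing order of labels, and require that the two
ends of a pair have opposite directions.  Pairing and swapping the two ends
of an edge are two involutions on the edge ends, so alternately following
them gives paths and even cycles, which can be coloured consistently
([two_involutions_colouring]).  The sum at a vertex then is an alternating
sum of a decreasing sequence up to the signs of the pairs, which its first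
term bounds ([paired_sum_bound]). *)

(** * Two-colourings compatible with two involutions *)

(** The orbits of [g \o f] are coloured.  As conjugation by [f] inverts
[g \o f], the map [f] permutes these orbits.  It fixes none: if [i + 2] steps
lead from [x] to [f x], then [i] steps lead from [h x] to [f (h x)], where [h]
is [g \o f], and repeating this ends at a fixed point of [f] or of [g].  So
the colour can record which of the orbits of [x] and [f x] comes first, and
[g x] lies in the orbit of [f x]. *)
Lemma free_involutions_colouring (X : finType) (f g : X -> X) :
  involutive f -> involutive g ->
  (forall x, f x != x) -> (forall x, g x != x) ->
  exists c : pred X, (forall x, c (f x) = ~~ c x) /\ (forall x, c (g x) = ~~ c x).
Proof.
move=> fK gK fx gx; pose h := g \o f.
have h_inj : injective h by apply: inj_comp; apply: inv_inj.
have hfh y : h (f (h y)) = f y by rewrite /h /= fK gK.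
have sep i : forall x, iter i h x <> f x.
  have [n] := ubnP i; elim: n i => // n IHn [|[|i]] lt_in x.
  - by move/esym/eqP; apply/negP.
  - by move/eqP; apply/negP; exact: gx.
  rewrite iterSr iterS -hfh => /h_inj; apply: IHn; lia.
have rootE x y : (froot h x == froot h y) = fconnect h x y.
  exact: root_connect (fconnect_sym h_inj) x y.
have root_f x : froot h x != froot h (f x).
  by rewrite rootE; apply/negP => /iter_findex /sep.
have root_g x : froot h (g x) = froot h (f x).
  apply/esym/eqP; rewrite rootE; have := fconnect1 h (f x).
  by rewrite /h /= fK.
have root_fg x : froot h (f (g x)) = froot h x.
  apply/eqP; rewrite rootE; have := fconnect1 h (f (g x)).
  by rewrite /h /= fK gK.
pose c x := (enum_rank (froot h x) < enum_rank (froot h (f x)))%N.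
have cf x : c (f x) = ~~ c x.
  rewrite /c fK; case: ltngtP => // /val_inj/enum_rank_inj/eqP.
  by rewrite eq_sym (negbTE (root_f x)).
exists c; split=> // x; rewrite -cf /c root_g root_fg fK //.
Qed.

(** Two copies of [X] reduce this to the fixed-point-free case: at its fixed
points an involution exchanges the copies instead. *)
Lemma two_involutions_colouring (X : finType) (f g : X -> X) :
  involutive f -> involutive g ->
  exists c : pred X,
    (forall x, f x != x -> c (f x) = ~~ c x) /\
    (forall x, g x != x -> c (g x) = ~~ c x).
Proof.
pose lift (h : X -> X) (p : X * bool) :=
  if h p.1 == p.1 then (p.1, ~~ p.2) else (h p.1, p.2).
have liftK h : involutive h -> involutive (lift h).
  move=> hK [x b]; rewrite /lift /=; have [hx|hx] := eqVneq (h x) x.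
    by rewrite /= hx eqxx negbK.
  by rewrite /= hK eq_sym (negbTE hx).
have lift_free h p : lift h p != p.
  case: p => x b; rewrite /lift /=; have [hx|hx] := eqVneq (h x) x.
    by rewrite xpair_eqE eqxx; case: b.
  by rewrite xpair_eqE (negbTE hx).
move=> fK gK.
have [c [cf cg]] := free_involutions_colouring (liftK _ fK) (liftK _ gK)
  (lift_free f) (lift_free g).
exists (fun x => c (x, true)); split=> x hx.
  by rewrite -cf /lift /= (negbTE hx).
by rewrite -cg /lift /= (negbTE hx).
Qed.

(** * Balanced orientations *)

Definition signed (b : bool) (n : nat) : int :=
  (if b then n%:Z else - n%:Z)%R.

(** The first pair contributes, up to sign, the difference [l x - l y] of its
labels, and by induction the remaining terms contribute at most [l y]; the
total is at most [l x].  Decreasing order matters: an unpaired last term is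
then the smallest. *)
Lemma paired_sum_bound (A : Type) (c : pred A) (l : A -> nat) (x0 : A)
    (s : seq A) (M : nat) :
  sorted (fun x y => l y <= l x) s -> all (fun x => l x <= M) s ->
  (forall i, i.*2.+1 < size s -> c (nth x0 s i.*2.+1) = ~~ c (nth x0 s i.*2)) ->
  (`|\sum_(x <- s) signed (c x) (l x)| <= M%:Z)%R.
Proof.
have [n] := ubnP (size s); elim: n s M => // n IHn [|x [|y s]] M /=.
- by rewrite big_nil.
- rewrite big_seq1 /signed; case: (c x) => *; lia.
rewrite ltnS => le_sn /andP[lyx srt] /andP[lxM _] cP.
have cy : c y = ~~ c x by apply: (cP 0).
have ly : all (fun x => l x <= l y) s.
  by apply: (order_path_min _ srt) => ? ? ? /[swap]; apply: leq_trans.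
have IH := IHn s (l y) (ltnW le_sn) (path_sorted srt) ly (fun i => cP i.+1).
rewrite !big_cons cy; move: (\sum_(z <- s) _)%R IH => S.
by rewrite /signed; case: (c x) => /= IH; lia.
Qed.

(** [excess r d l v] is the oriented vertex sum of [v] in the graph [r] when
[d u v] says that the edge [uv] points to [v]; labels sit on unordered
edges, so that they can be chosen independently of the orientation. *)
Definition excess (T : finType) (r d : rel T) (l : {set T} -> nat) (v : T) : int :=
  (\sum_(u | r v u) signed (d u v) (l [set u; v]))%R.

(** The pair [(u, v)] stands for the end at [v] of the edge [uv], and its
colour says whether the edge points to [v]. *)
Lemma balanced_orientation (T : finType) (r : rel T) (l : {set T} -> nat) :
  symmetric r -> irreflexive r ->
  exists d : rel T,
    (forall u v, r u v -> d u v (+) d v u) /\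
    (forall v (M : nat), (forall u, r v u -> l [set u; v] <= M) ->
       (`|excess r d l v| <= M%:Z)%R).
Proof.
move=> r_sym r_irr.
pose N v := sort (fun x y => l [set y; v] <= l [set x; v]) (enum (r v)).
have memN v u : (u \in N v) = r v u by rewrite mem_sort mem_enum.
have uniqN v : uniq (N v) by rewrite sort_uniq enum_uniq.
pose flip i := if odd i then i.-1 else i.+1.
have flipK : involutive flip.
  case=> // i; rewrite /flip /=; case: (boolP (odd i)) => /= [->|] //.
  by rewrite -if_neg => ->.
(* Without a partner in the list, [nth] returns its default [u]. *)
pose mate v u := if r v u then nth u (N v) (flip (index u (N v))) else u.
have mateK v : involutive (mate v).
  move=> u; rewrite /mate; case rvu: (r v u); last by rewrite rvu.
  case: (ltnP (flip (index u (N v))) (size (N v))) => lt_i; last first.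
    by rewrite nth_default // rvu nth_default.
  rewrite -memN mem_nth // index_uniq // flipK.
  by rewrite (set_nth_default u) ?nth_index ?memN // index_mem memN.
pose f (p : T * T) := (p.2, p.1).
pose g (p : T * T) := (mate p.2 p.1, p.2).
have fK : involutive f by case.
have gK : involutive g by case=> u v; rewrite /g /= mateK.
have [c [cf cg]] := two_involutions_colouring fK gK.
exists (fun u v => c (u, v)); split=> [u v ruv|v M lM].
  have uv : u != v by apply: contraTneq ruv => ->; rewrite r_irr.
  rewrite -[(v, u)]/(f (u, v)) cf ?addbN ?addbb //.
  by rewrite /f xpair_eqE negb_and eq_sym uv.
have -> : excess r (fun u v => c (u, v)) l v =
    (\sum_(u <- N v) signed (c (u, v)) (l [set u; v]))%R.
  by rewrite /N (perm_big (enum (r v))) ?big_enum // perm_sort.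
apply: (@paired_sum_bound _ (fun u => c (u, v)) (fun u => l [set u; v]) v).
- by apply: sort_sorted => x y; apply: leq_total.
- by apply/allP => u; rewrite memN; apply: lM.
move=> i lt_i; have lt_i' := ltnW lt_i.
set u := nth v (N v) i.*2.
have rvu : r v u by rewrite -memN mem_nth.
have mE : mate v u = nth v (N v) i.*2.+1.
  by rewrite /mate rvu index_uniq // /flip odd_double (set_nth_default v).
rewrite -mE -[(mate v u, v)]/(g (u, v)) cg //.
by rewrite /g /= xpair_eqE mE eqxx andbT nth_uniq // gtn_eqF.
Qed.

(** * Separating vertices by the last labels *)

Lemma separating_order (T : finType) (A : {set T}) (p : T -> int) :
  exists s : seq T, [/\ uniq s, s =i A &
    {in A &, injective (fun v => (p v + (index v s)%:Z)%R)}].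
Proof.
pose s := sort (fun u v => (p u <= p v)%R) (enum A).
have memS : s =i A by move=> v; rewrite mem_sort mem_enum.
exists s; split=> //; first by rewrite sort_uniq enum_uniq.
have srt : sorted (fun u v => (p u <= p v)%R) s.
  by apply: sort_sorted => u v; apply: le_total.
have mono u v : u \in A -> v \in A -> (index u s < index v s)%N ->
    (p u <= p v)%R.
  rewrite -!memS => us vs lt_uv.
  by apply: (sorted_ltn_index _ srt) => // x y z; apply: le_trans.
move=> u v uA vA /= eq_uv.
apply: (index_inj u (s := s)); rewrite ?memS //.
case: (ltngtP (index u s) (index v s)) => // lt; have := mono _ _ _ _ lt; lia.
Qed.

(** * Oriented sums and edges *)

Lemma vertex_sum_excess (T : finType) (e : rel T) (D : {set T * T})
    (l : {set T} -> nat) (v : T) :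
  symmetric e -> orientation e D ->
  vertex_sum D (fun p => l [set p.1; p.2]) v =
    excess e (fun u w => (u, w) \in D) l v.
Proof.
move=> e_sym [De Dx]; rewrite /excess (bigID (fun u => (u, v) \in D)) /=.
congr (_ + _)%R.
  apply: eq_big => [u|u ->] //.
  by apply/idP/andP => [uvD|[]//]; rewrite e_sym (De _ _ uvD).
rewrite -sumrN; apply: eq_big => [u|u vuD].
  apply/idP/andP => [vuD|[vu]]; first by have := De _ _ vuD; split=> //;
    have := Dx _ _ (De _ _ vuD); rewrite vuD.
  by have := Dx _ _ vu; case: ((v, u) \in D) => //= ->.
have := Dx _ _ (De _ _ vuD); rewrite vuD /= => /negbTE ->.
by rewrite /signed setUC.
Qed.

Lemma mem_edges (T : finType) (e : rel T) (u v : T) :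
  symmetric e -> ([set u; v] \in edges e) = e u v.
Proof.
move=> e_sym; apply/imsetP/idP => [[[x y]]|uv]; last first.
  by exists (u, v); rewrite ?inE.
rewrite inE /= => exy /eqP; rewrite eqEsubset !subUset !sub1set !inE.
by case/andP=> /andP[]; do 2 case/orP=> /eqP ->; case/andP;
  do 2 case/orP=> /eqP ?; subst => //; rewrite e_sym.
Qed.

Lemma edgesP (T : finType) (e : rel T) (x : {set T}) :
  reflect (exists u v, e u v /\ x = [set u; v]) (x \in edges e).
Proof.
apply: (iffP imsetP) => [[[u v]]|[u [v [uv ->]]]].
  by rewrite inE /= => uv ->; exists u, v.
by exists (u, v); rewrite ?inE.
Qed.

Lemma index_map_in (A B : eqType) (f : A -> B) (s : seq A) (x : A) :
  {in s &, injective f} -> uniq s -> x \in s ->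
  index (f x) (map f s) = index x s.
Proof.
move=> f_inj s_uniq xs; rewrite -{1}(nth_index x xs) -(nth_map x (f x)) ?index_mem //.
by rewrite index_uniq ?size_map ?index_mem ?map_inj_in_uniq.
Qed.

(** * Labelling the edges that leave the clique *)

(** The sequence [s] lists the edges in the order of their labels, which start
at [a + 1].  It ends with the edges [F w] joining each outer vertex [w] to a
neighbour [f w] in [K], since only their order is adapted to the other
labels; each lies at a single outer vertex, so reordering them changes no
outer sum other than by its own term. *)
Lemma outer_labelling (T : finType) (e : rel T) (K : {set T}) (a : nat) :
  symmetric e -> irreflexive e ->
  (forall w, w \notin K -> exists2 u, u \in K & e w u) ->
  exists (s : seq {set T}) (d : rel T),
    let l x := a + (index x s).+1 in
    [/\ uniq s,
        s =i [set x in edges e | ~~ (x \subset K)],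
        forall u v, e u v -> ~~ ((u \in K) && (v \in K)) -> d u v (+) d v u,
        forall u v, u \in K -> v \notin K -> d u v &
        (forall w, w \notin K -> (0 < excess e d l w)%R) /\
        {in ~: K &, injective (excess e d l)}].
Proof.
move=> e_sym e_irr domK.
pose f w := odflt w [pick u in K | e w u].
have fP w : w \notin K -> f w \in K /\ e w (f w).
  move=> wK; rewrite /f; case: pickP => [u /andP[]//|none].
  by have [u uK wu] := domK w wK; have := none u; rewrite uK wu.
pose F w := [set f w; w].
have F_mem w u v :
    w \notin K -> v \notin K -> F w = [set u; v] -> w = v /\ u = f w.
  move=> wK vK eqF; have [fK ef] := fP w wK.
  have : v \in F w by rewrite eqF set22.
  rewrite !inE => /orP[/eqP vf|/eqP vw]; first by rewrite vf fK in vK.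
  split=> //; have : f w \in [set u; v] by rewrite -eqF set21.
  rewrite !inE => /orP[/eqP //|/eqP fv]; by rewrite -fv fK in vK.
pose R := enum [set x in edges e | ~~ (x \subset K) & x \notin F @: ~: K].
pose l0 (x : {set T}) := a + (index x R).+1.
pose rW : rel T := fun u v => [&& e u v, u \notin K & v \notin K].
have rW_sym : symmetric rW.
  by move=> u v; rewrite /rW e_sym [(u \notin K) && _]andbC.
have rW_irr : irreflexive rW by move=> u; rewrite /rW e_irr.
have [dW [dW_anti dW_bound]] := balanced_orientation l0 rW_sym rW_irr.
pose d : rel T := fun u v => if u \in K then v \notin K else (v \notin K) && dW u v.
(* [p w] is the sum at [w] before its edge [F w] is labelled. *)
pose p w := (\sum_(u | e w u && (u != f w)) signed (d u w) (l0 [set u; w]))%R.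
have [sW [sW_uniq memW sW_inj]] := separating_order (~: K) p.
pose s := R ++ map F sW.
have in_sW w : (w \in sW) = (w \notin K) by rewrite memW inE.
have in_FsW : map F sW =i F @: ~: K.
  move=> x; apply/mapP/imsetP => -[w]; last by rewrite inE -in_sW; exists w.
  by rewrite in_sW => wK ->; exists w; rewrite ?inE.
have in_R w u : w \notin K -> e w u -> u != f w -> [set u; w] \in R.
  move=> wK wu uf; rewrite mem_enum inE mem_edges // e_sym wu.
  rewrite subUset !sub1set (negbTE wK) andbF /=.
  apply/imsetP => -[v]; rewrite inE => vK /esym/F_mem[] // vw uv.
  by rewrite uv vw eqxx in uf.
have F_notin_R w : w \notin K -> F w \notin R.
  by move=> wK; rewrite mem_enum !inE imset_f ?inE // !andbF.
have F_inj : {in sW &, injective F}.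
  by move=> u v; rewrite !in_sW => uK vK /F_mem[].
pose l x := a + (index x s).+1.
have l_R w u : w \notin K -> e w u -> u != f w -> l [set u; w] = l0 [set u; w].
  by move=> wK wu uf; rewrite /l /s index_cat in_R.
have l_F w : w \notin K -> l (F w) = a + (size R + index w sW).+1.
  move=> wK; rewrite /l /s index_cat (negbTE (F_notin_R _ wK)).
  by rewrite index_map_in ?in_sW.
have d_F w : w \notin K -> d (f w) w.
  by move=> wK; rewrite /d (fP w wK).1.
have excess_W w : w \notin K ->
    excess e d l w = (p w + (a + (size R + index w sW).+1)%:Z)%R.
  move=> wK; rewrite /excess (bigD1 (f w)) ?(fP w wK).2 //= addrC d_F //.
  rewrite -/(F w) l_F //; congr (_ + _)%R.
  by apply: eq_bigr => u /andP[wu uf]; rewrite l_R.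
exists s, d; split.
- rewrite cat_uniq enum_uniq map_inj_in_uniq // sW_uniq andbT /=.
  by apply/hasPn => x /mapP[w]; rewrite in_sW => wK ->; apply: F_notin_R.
- move=> x; rewrite mem_cat in_FsW mem_enum !inE.
  have [/imsetP[w wK ->]|_] := boolP (x \in F @: ~: K); last by rewrite orbF andbT.
  rewrite orbT; rewrite inE in wK.
  by rewrite mem_edges // e_sym (fP w wK).2 subUset !sub1set (negbTE wK) andbF.
- move=> u v uv; rewrite /d; case: (boolP (u \in K)); case: (boolP (v \in K)) => //=.
  by move=> vK uK _; apply: dW_anti; rewrite /rW uv uK vK.
- by move=> u v uK vK; rewrite /d uK.
rewrite -/l; split=> [w wK|u v]; last first.
  rewrite !inE => uK vK; rewrite !excess_W // => eq_uv.
  by apply: sW_inj; rewrite ?inE //=; lia.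
(* Labels inside [W] are at most [a + size R], below the label of [F w]. *)
have [fK ef] := fP w wK.
rewrite /excess (bigID (mem K)) /= (bigD1 (f w)) ?fK ?ef //= d_F // -/(F w) l_F //.
set S1 := (\sum_(_ | _) _)%R; set S2 := (\sum_(_ | _) _)%R.
have S1_ge0 : (0 <= S1)%R.
  by apply: sumr_ge0 => u /andP[/andP[_ uK] _]; rewrite /d uK wK.
have S2E : S2 = excess rW dW l0 w.
  apply: eq_big => [u|u /andP[wu uK]]; first by rewrite /rW wK.
  rewrite /d (negbTE uK) wK l_R //.
  by apply: contraNneq uK => ->.
have : (`|S2| <= (a + size R)%:Z)%R.
  rewrite S2E; apply: dW_bound => u /and3P[wu _ uK].
  rewrite /l0 leq_add2l index_mem in_R //; by apply: contraNneq uK => ->.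
rewrite /signed; lia.
Qed.

(** * Labelling the edges of the clique *)

(** With [z] of least load, the star at [z] comes first in the order of
labels.  The number of edges of the clique equals 1 + ... + (#|K| - 1), the
sum of the star labels, and this coincidence is what puts [z] strictly above
all others: it is both the gain of [z] and the largest label in use. *)
Lemma inner_labelling (T : finType) (K : {set T}) (P : T -> int) :
  K != set0 ->
  exists (s : seq {set T}) (d : rel T),
    let l x := (index x s).+1 in
    let r u v := [&& u \in K, v \in K & u != v] in
    [/\ uniq s,
        s =i [set x : {set T} | x \subset K & #|x| == 2],
        forall u v, r u v -> d u v (+) d v u,
        forall v, v \in K -> (excess r d l v <= ('C(#|K|, 2))%:Z)%R &
        {in K &, injective (fun v => excess r d l v - P v)%R}].
Proof.
case/set0Pn=> v0 v0K.
have [z zK z_min] := Order.TotalTheory.arg_minP P v0K.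
have {}zK : z \in K by exact: zK.
pose A := K :\ z; pose k := #|A|.
have cardK : #|K| = k.+1 by rewrite (cardsD1 z) zK.
have AK v : v \in A -> v \in K by case/setD1P.
have zA : z \notin A by rewrite !inE eqxx.
pose R := enum [set x : {set T} | x \subset A & #|x| == 2].
have size_R : size R = 'C(k, 2) by rewrite -cardE cards_draws.
pose l0 (x : {set T}) := (k + index x R).+1.
pose rA : rel T := fun u v => [&& u \in A, v \in A & u != v].
have rA_sym : symmetric rA.
  by move=> u v; rewrite /rA eq_sym andbA [(u \in A) && _]andbC -andbA.
have rA_irr : irreflexive rA by move=> u; rewrite /rA eqxx !andbF.
have [dA [dA_anti dA_bound]] := balanced_orientation l0 rA_sym rA_irr.
have [sA [sA_uniq memA sA_inj]] :=
  separating_order A (fun v => P v - excess rA dA l0 v)%R.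
have size_sA : size sA = k by rewrite /k -(card_uniqP sA_uniq); apply: eq_card.
pose star v := [set v; z].
have star_inj : {in sA &, injective star}.
  move=> u v; rewrite !memA => uA vA eq_uv.
  have : u \in star v by rewrite -eq_uv set21.
  by rewrite !inE => /orP[/eqP //|/eqP uz]; rewrite uz (negbTE zA) in uA.
pose s := map star sA ++ R.
pose l x := (index x s).+1.
pose r : rel T := fun u v => [&& u \in K, v \in K & u != v].
pose d : rel T := fun u v => if v == z then true else (u != z) && dA u v.
have l_star v : v \in A -> l (star v) = (index v sA).+1.
  move=> vA; rewrite /l /s index_cat map_f ?memA // index_map_in ?memA //.
have inR u v : rA v u -> [set u; v] \in R.
  case/and3P=> vA uA vu; rewrite mem_enum inE subUset !sub1set uA vA /=.
  by rewrite cards2 [u == v]eq_sym vu.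
have star_notin_A x : x \in map star sA -> ~~ (x \subset A).
  by case/mapP=> v _ ->; rewrite subUset !sub1set (negbTE zA) andbF.
have l_R u v : rA v u -> l [set u; v] = l0 [set u; v].
  move=> vu; rewrite /l /s index_cat; case: ifP => [/star_notin_A|_].
    by case/and3P: vu => vA uA _; rewrite subUset !sub1set uA vA.
  by rewrite size_map size_sA.
(* [z] collects the labels 1, ..., k of its star. *)
have excess_z : (excess r d l z = ('C(#|K|, 2))%:Z)%R.
  transitivity (\sum_(v in A) ((index v sA).+1)%:Z)%R.
    apply: eq_big => [v|v /and3P[_ vK zv]].
      by rewrite /r zK !inE /= [z == v]eq_sym andbC.
    by rewrite /d eqxx /signed -/(star v) l_star // !inE eq_sym zv.
  rewrite -(big_morph Posz PoszD (erefl 0%:Z)%R); congr Posz.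
  rewrite -(eq_bigl _ _ memA) -big_uniq //= (big_nth z) size_sA.
  rewrite cardK -bin2_sum big_nat_recl // add0n.
  by apply: eq_big_nat => i /andP[_ lt_i]; rewrite index_uniq // size_sA.
have excess_A v : v \in A ->
    excess r d l v = (excess rA dA l0 v - ((index v sA).+1)%:Z)%R.
  move=> vA; have vz : v != z by apply: contraTneq vA => ->.
  rewrite /excess (bigD1 z) /=; last by rewrite /r AK // zK.
  rewrite addrC; congr (_ + _)%R.
    apply: eq_big => [u|u]; first by rewrite /r /rA !inE vz /= -!andbA; do !bool_congr.
    case/andP=> /and3P[vK uK vu] uz.
    have vuA : rA v u by rewrite /rA vA !inE uz uK.
    by rewrite l_R // /d (negbTE vz) uz.
  by rewrite /d (negbTE vz) eqxx /= /signed setUC -/(star v) l_star.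
have excess_A_le v : v \in A -> (excess r d l v < ('C(#|K|, 2))%:Z)%R.
  move=> vA; rewrite excess_A //.
  have : (`|excess rA dA l0 v| <= ('C(#|K|, 2))%:Z)%R.
    apply: dA_bound => u vu; rewrite cardK binS bin1 addnC /l0 ltn_add2l.
    by rewrite -size_R index_mem inR.
  lia.
have z_or_A v : v \in K -> v = z \/ v \in A.
  by move=> vK; rewrite !inE vK andbT; case: eqVneq; [left|right].
have z_sep v : v \in A -> (excess r d l v - P v < excess r d l z - P z)%R.
  by move=> vA; have := excess_A_le v vA; have := z_min v (AK v vA); lia.
exists s, d; rewrite -/l -/r; split.
- rewrite cat_uniq map_inj_in_uniq // sA_uniq enum_uniq andbT /=.
  by apply/hasPn => x; rewrite mem_enum inE => /andP[xA _];
    apply: contraL xA => /star_notin_A.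
- move=> x; rewrite mem_cat mem_enum !inE.
  apply/orP/andP => [[/mapP[v]|/andP[xA x2]]|[xK x2]].
  + rewrite memA => vA ->; rewrite subUset !sub1set zK AK // cards2.
    by rewrite (contraNneq _ zA) // => <-.
  + by split=> //; apply: subset_trans xA (subD1set _ _).
  case/cards2P: x2 => u [v [uv xE]]; move: xK; rewrite xE subUset !sub1set.
  case/andP.
  case/z_or_A=> [uz|uA]; case/z_or_A => [vz|vA].
  + by rewrite uz vz eqxx in uv.
  + by left; rewrite uz setUC -/(star v) map_f // memA.
  + by left; rewrite vz -/(star u) map_f // memA.
  + by right; rewrite subUset !sub1set uA vA cards2 uv.
- move=> u v /and3P[uK vK uv]; rewrite /d.
  case: (z_or_A u uK) (z_or_A v vK) uv => [->|uA] [->|vA] uv.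
  + by rewrite eqxx in uv.
  + by rewrite eqxx [v == z]eq_sym (negbTE uv).
  + by rewrite eqxx (negbTE uv).
  have [uz vz] : u != z /\ v != z by split; apply: contraNneq zA => <-.
  by rewrite (negbTE uz) (negbTE vz) /=; apply: dA_anti; rewrite /rA uA vA.
- move=> v /z_or_A[->|vA]; first by rewrite excess_z.
  exact/ltW/excess_A_le.
move=> u v /z_or_A[->|uA] /z_or_A[->|vA] // eq_uv.
- by have := z_sep v vA; rewrite eq_uv ltxx.
- by have := z_sep u uA; rewrite eq_uv ltxx.
by move: eq_uv; rewrite !excess_A // => eq_uv; apply: sA_inj => //=; lia.
Qed.

(** * Combining the two labellings *)

(** A clique of least size works: if [v] in [K] has no neighbour outside [K]
while some [w] lies outside, then [w] is dominated by another vertex of [K],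
and [K] without [v] still dominates. *)
Lemma dominating_clique_outer_neighbour (T : finType) (e : rel T) :
  symmetric e -> (exists K : {set T}, dominating_clique e K) ->
  exists K : {set T}, dominating_clique e K /\
    forall v w, v \in K -> w \notin K -> exists2 x, x \notin K & e v x.
Proof.
move=> e_sym [K0 K0dom].
have [n] := ubnP #|K0|; elim: n K0 K0dom => // n IHn K [K0 clK domK] le_Kn.
have [ok|] := boolP [forall v in K, forall w,
    (w \notin K) ==> [exists x, (x \notin K) && e v x]].
  exists K; split=> // v w vK wK.
  have /existsP[x /andP[xK vx]] := implyP (forallP (forall_inP ok v vK) w) wK.
  by exists x.
case/forall_inPn=> v vK /forallPn[w]; rewrite negb_imply.
case/andP=> wK /existsPn no_x.
have in_K x : e v x -> x \in K.
  by move=> vx; apply: contraTT (no_x x) => ->; rewrite vx.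
have [] := domK w; first by rewrite (negbTE wK).
case=> u uK wu; have uv : u != v.
  by apply: contraNneq wK => uv; apply: in_K; rewrite e_sym -uv.
apply: (IHn (K :\ v)); last by move: le_Kn; rewrite (cardsD1 v) vK.
split.
- by apply/set0Pn; exists u; rewrite !inE uv.
- by move=> x y /setD1P[_ xK] /setD1P[_ yK]; apply: clK.
move=> x; have [->|xv] := eqVneq x v.
  by right; exists u; rewrite ?inE ?uv // clK // eq_sym.
have [xK|[y yK xy]] := domK x; first by left; rewrite !inE xv.
have [yv|yv] := eqVneq y v; last by right; exists y; rewrite // !inE yv.
by left; rewrite !inE xv in_K // e_sym -yv.
Qed.

Theorem theorem1p4 (T : finType) (e : rel T)
    (e_sym : symmetric e) (e_irr : irreflexive e)
    (has_dom_clique : exists K : {set T}, dominating_clique e K) :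
  admits_antimagic_orientation e.
Proof.
have [K [[K0 clK domK] nbrK]] :=
  dominating_clique_outer_neighbour e_sym has_dom_clique.
have domW w : w \notin K -> exists2 u, u \in K & e w u.
  by move=> wK; have [|//] := domK w; rewrite (negbTE wK).
pose a := 'C(#|K|, 2).
have [s1 [d1 [s1_uniq mem_s1 d1_anti d1_KW [pos1 inj1]]]] :=
  outer_labelling a e_sym e_irr domW.
pose l1 (x : {set T}) := a + (index x s1).+1.
rewrite -/l1 in pos1 inj1.
pose P v := (\sum_(w | e v w && (w \notin K)) (l1 [set w; v])%:Z)%R.
have [s2 [d2 [s2_uniq mem_s2 d2_anti le2 inj2]]] := inner_labelling P K0.
pose l2 (x : {set T}) := (index x s2).+1.
pose r : rel T := fun u v => [&& u \in K, v \in K & u != v].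
rewrite -/l2 -/r in le2 inj2.
have r_e v u : v \in K -> r v u = e v u && (u \in K).
  move=> vK; rewrite /r vK /=; case: (boolP (u \in K)) => uK; last by rewrite andbF.
  rewrite andbT; apply/idP/idP => [|vu]; first exact: clK.
  by apply: contraTneq vu => ->; rewrite e_irr.
have size_s2 : size s2 = a.
  by rewrite -(card_uniqP s2_uniq) (eq_card mem_s2) cards_draws.
pose s := s2 ++ s1.
pose l x := (index x s).+1.
have s1_notin_s2 x : x \in s1 -> x \notin s2.
  by rewrite mem_s1 mem_s2 !inE => /andP[_ /negbTE ->].
have s_uniq : uniq s.
  by rewrite cat_uniq s1_uniq s2_uniq andbT; apply/hasPn => x /s1_notin_s2.
have mem_s : s =i edges e.
  move=> x; rewrite mem_cat mem_s1 mem_s2 !inE.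
  have [xK|xK] /= := boolP (x \subset K); last by rewrite andbT.
  rewrite andbF orbF; apply/idP/edgesP => [/cards2P[u [v [uv xE]]]|[u [v [uv ->]]]].
    exists u, v; split=> //; move: xK; rewrite xE subUset !sub1set.
    by case/andP=> uK vK; apply: clK.
  by rewrite cards2; have [uv'|//] := eqVneq u v; rewrite uv' e_irr in uv.
have l_out u v :
    e u v -> ~~ ((u \in K) && (v \in K)) -> l [set u; v] = l1 [set u; v].
  move=> uv uvK; rewrite /l /s index_cat ifN ?size_s2 -?addnS //.
  by apply: s1_notin_s2; rewrite mem_s1 inE mem_edges // uv subUset !sub1set.
have l_in u v : r u v -> l [set u; v] = l2 [set u; v].
  case/and3P=> uK vK uv; rewrite /l /s index_cat mem_s2 inE.
  by rewrite subUset !sub1set uK vK cards2 uv.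
pose d u v := if (u \in K) && (v \in K) then d2 u v else d1 u v.
pose D := [set p : T * T | e p.1 p.2 && d p.1 p.2].
have D_or : orientation e D.
  split=> u v; first by rewrite inE => /andP[].
  move=> uv; rewrite !inE /= [e v u]e_sym uv /= /d [(v \in K) && _]andbC.
  case: ifP => [uvK|/negbT uvK]; last exact: d1_anti.
  by apply: d2_anti; rewrite -/(r u v) r_e ?uv //; case/andP: uvK.
have excess_out v : v \notin K ->
    vertex_sum D (fun p => l [set p.1; p.2]) v = excess e d1 l1 v.
  move=> vK; rewrite (vertex_sum_excess l v e_sym D_or); apply: eq_bigr => u vu.
  rewrite inE /= e_sym vu /d (negbTE vK) andbF /= l_out //; first by rewrite e_sym.
  by rewrite (negbTE vK) andbF.
have excess_in v : v \in K ->
    vertex_sum D (fun p => l [set p.1; p.2]) v = (excess r d2 l2 v - P v)%R.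
  move=> vK; rewrite (vertex_sum_excess l v e_sym D_or) /excess (bigID (mem K)) /=.
  congr (_ + _)%R.
    apply: eq_big => [u|u /andP[vu uK]]; first by rewrite r_e.
    by rewrite inE /= e_sym vu /d uK vK /= setUC l_in // r_e // vu.
  rewrite -sumrN; apply: eq_bigr => u /andP[vu uK].
  rewrite inE /= e_sym vu /d (negbTE uK) /=.
  have /negbTE -> : ~~ d1 u v.
    by have := d1_anti v u vu; rewrite (negbTE uK) andbF d1_KW // => /(_ isT).
  by rewrite /signed l_out ?(negbTE uK) // e_sym.
(* A vertex of [K] gains at most [a] inside [K] and loses more than [a] along
   any single edge to the outside. *)
have in_lt_out v w : v \in K -> w \notin K ->
    (vertex_sum D (fun p => l [set p.1; p.2]) v <
     vertex_sum D (fun p => l [set p.1; p.2]) w)%R.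
  move=> vK wK; rewrite excess_in // excess_out //.
  have [x xK vx] := nbrK v w vK wK.
  have P_gt : (a%:Z < P v)%R.
    rewrite /P (bigD1 x) ?vx //=; set S := (\sum_(_ | _) _)%R.
    have : (0 <= S)%R by apply: sumr_ge0.
    rewrite /l1; lia.
  have := pos1 w wK; have := le2 v vK; rewrite -/a; lia.
exists D, (fun p => l [set p.1; p.2]); split=> //.
- have card_m : #|edges e| = size s.
    by rewrite -(card_uniqP s_uniq); apply: eq_card => x; rewrite mem_s.
  rewrite card_m; split.
  + move=> [u v] [x y] uvD xyD /= [].
    have [uv xy] := (D_or.1 _ _ uvD, D_or.1 _ _ xyD).
    move/(index_inj set0); rewrite !mem_s !mem_edges // => /(_ uv xy) eq_uv.
    have := set21 u v; have := set22 u v; rewrite eq_uv !inE.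
    case/orP=> /eqP vE; case/orP=> /eqP uE; subst=> //.
    * by rewrite e_irr in uv.
    * by have := D_or.2 _ _ uv; rewrite uvD xyD.
    * by rewrite e_irr in uv.
  + move=> [u v]; rewrite inE /= => /andP[uv _].
    by rewrite /l index_mem mem_s mem_edges.
  case=> // k /= lt_k.
  have : nth set0 s k \in edges e by rewrite -mem_s mem_nth.
  case/edgesP=> u [v [uv xE]].
  have lk : l [set u; v] = k.+1 by rewrite /l -xE index_uniq.
  have := D_or.2 u v uv; case: (boolP ((u, v) \in D)) => [uvD|_ /= vuD].
    by exists (u, v).
  by exists (v, u) => //=; rewrite setUC.
move=> u v eq_uv; have [uK|uK] := boolP (u \in K); have [vK|vK] := boolP (v \in K).
- by apply: inj2 => //=; rewrite -!excess_in.
- by have := in_lt_out u v uK vK; rewrite eq_uv ltxx.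
- by have := in_lt_out v u vK uK; rewrite eq_uv ltxx.
by apply: inj1; rewrite ?inE // -!excess_out.
Qed.
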